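(* Let $R$ be an F-noetherian domain. Then $R$ is an Ore domain (left and right).
   Context: All rings have an identity $1$, and subrings contain $1$; ''noetherian'' means left and right noetherian. A ring $R$ is F-noetherian if every finite subset of $R$ is contained in a noetherian subring of $R$. A domain (not necessarily commutative) is a right Ore domain if $aR\cap bR\neq 0$ for all nonzero $a,b\in R$, and a left Ore domain if $Ra\cap Rb\ne 0$ for all nonzero $a,b\in R$. *)

(* Defs.v *)
From HB Require Import structures.
From mathcomp Require Import all_boot all_order all_algebra.

Set Implicit Arguments.
Unset Strict Implicit.
Unset Printing Implicit Defensive.

Import GRing.Theory.
Local Open Scope ring_scope.

(* Subsets (ideals, subrings) are MathComp collective predicates {pred A}.
   With the axioms of mathcomp.classical.boolp every P : A -> Prop is
   represented by such a predicate, namely [pred x | `[< P x >]], so these are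
   all subsets of A and not only the decidable ones. *)

Definition left_ideal (A : pzRingType) (I : {pred A}) : Prop :=
  GRing.zmod_closed I /\ (forall a x : A, x \in I -> a * x \in I).

Definition right_ideal (A : pzRingType) (I : {pred A}) : Prop :=
  GRing.zmod_closed I /\ (forall a x : A, x \in I -> x * a \in I).

Definition left_noetherian (A : pzRingType) : Prop :=
  forall I : nat -> {pred A},
    (forall n, left_ideal (I n)) ->
    (forall n, {subset I n <= I n.+1}) ->
    exists N : nat, forall n, (N <= n)%N -> I n =i I N.

Definition right_noetherian (A : pzRingType) : Prop :=
  forall I : nat -> {pred A},
    (forall n, right_ideal (I n)) ->
    (forall n, {subset I n <= I n.+1}) ->
    exists N : nat, forall n, (N <= n)%N -> I n =i I N.

Definition noetherian (A : pzRingType) : Prop :=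
  left_noetherian A /\ right_noetherian A.

(* The subring S of R as a ring in its own right. *)
Definition subring_type (R : pzRingType) (S : subringClosed R) : Type :=
  {x : R | x \in S}.

HB.instance Definition _ (R : pzRingType) (S : subringClosed R) :=
  [isSub of subring_type S for @sval R (fun x => x \in S)].
HB.instance Definition _ (R : pzRingType) (S : subringClosed R) :=
  [Choice of subring_type S by <:].
HB.instance Definition _ (R : pzRingType) (S : subringClosed R) :=
  GRing.SubChoice_isSubPzRing.Build R _ (subring_type S)
    (subringClosedP S).

Definition F_noetherian (R : pzRingType) : Prop :=
  forall s : seq R, exists S : subringClosed R,
    {subset s <= S} /\ noetherian (subring_type S).

(* Not necessarily commutative, hence weaker than idomainType; 1 != 0 is part
   of nzRingType. *)
Definition domain (R : nzRingType) : Prop :=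
  forall x y : R, x * y = 0 -> x = 0 \/ y = 0.

Definition right_ore_domain (R : nzRingType) : Prop :=
  domain R /\
  forall a b : R, a != 0 -> b != 0 ->
    exists2 z : R, z != 0 & (exists x, z = a * x) /\ (exists y, z = b * y).

Definition left_ore_domain (R : nzRingType) : Prop :=
  domain R /\
  forall a b : R, a != 0 -> b != 0 ->
    exists2 z : R, z != 0 & (exists x, z = x * a) /\ (exists y, z = y * b).

(* Main.v *)
Require Import Defs.
From mathcomp Require Import all_boot all_order all_algebra.
From mathcomp Require Import boolp.

(** The key is that a right noetherian ring [A] without zero divisors is right
    Ore.  For nonzero [a] and [b] the right ideals
    [b A + a b A + ... + a^(n-1) b A] form an ascending chain; where it stops,
    some [a^N b] is a right linear combination of the lower [a^i b]
    ([monomial_relation]).  The relation so obtained is nontrivial, and after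
    cancelling the largest possible power of [a] on the left it reads
    [b y = a x] with [y != 0], a nonzero common right multiple
    ([common_multiple_of_relation]).  The left Ore condition is the right one
    in the converse ring.  In an F-noetherian domain, two given nonzero
    elements lie in a noetherian subring, and a common multiple found there is
    one in the whole ring. *)

Set Implicit Arguments.
Unset Strict Implicit.
Unset Printing Implicit Defensive.

Import GRing.Theory.
Local Open Scope ring_scope.

(** Stated for possibly trivial rings, because the subrings of a ring carry
    only that structure. *)
Definition no_zero_divisors (A : pzRingType) : Prop :=
  forall x y : A, x * y = 0 -> x = 0 \/ y = 0.

(** Induction on the length: a nonzero coefficient of [b] gives the common
    multiple at once; otherwise all terms start with [a], and cancelling it
    shortens the relation. *)
Lemma common_multiple_of_relation (A : pzRingType) (a b : A) n (c : nat -> A) :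
    no_zero_divisors A -> a != 0 -> b != 0 ->
    \sum_(i < n) a ^+ i * b * c i = 0 ->
    (exists2 i, (i < n)%N & c i != 0) ->
  exists x y, a * x = b * y /\ b * y != 0.
Proof.
move=> domA a0 b0; elim: n c => [|n IHn] c; first by move=> _ [].
rewrite big_ord_recl expr0 mul1r.
have -> : \sum_(i < n) a ^+ lift ord0 i * b * c (lift ord0 i)
          = a * \sum_(i < n) a ^+ i * b * c i.+1.
  by rewrite mulr_sumr; apply: eq_bigr => i _; rewrite exprS !mulrA.
move=> rel [i lt_in ci0].
have [c00|c00] := eqVneq (c 0%N) 0; last first.
  exists (- \sum_(i < n) a ^+ i * b * c i.+1), (c 0%N); split.
    by rewrite mulrN; apply/esym/eqP; rewrite -addr_eq0; apply/eqP.
  by apply/eqP => /domA [] /eqP; apply/negP.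
move: rel; rewrite c00 mulr0 add0r => /domA [/eqP|rel].
  by rewrite (negPf a0).
apply: (IHn (fun j => c j.+1)) => //.
by case: i lt_in ci0 => [|i] lt_in; [rewrite c00 eqxx | exists i].
Qed.

(** Such an [n] is where the chain of right ideals generated by the [a ^+ i * b]
    with [i < n] becomes stationary. *)
Lemma monomial_relation (A : pzRingType) (a b : A) :
  right_noetherian A ->
  exists n, exists c : nat -> A, a ^+ n * b = \sum_(i < n) a ^+ i * b * c i.
Proof.
move=> noethA.
pose I n : {pred A} :=
  [pred x | `[< exists c : nat -> A, x = \sum_(i < n) a ^+ i * b * c i >]].
have [n|n x|N stabN] := noethA I.
- split; first split.
  + apply/asboolP; exists (fun=> 0).
    by rewrite big1 // => i _; rewrite mulr0.
  + move=> x y /asboolP [c ->] /asboolP [d ->].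
    apply/asboolP; exists (fun i => c i - d i).
    by rewrite -sumrB; apply: eq_bigr => i _; rewrite mulrBr.
  + move=> r x /asboolP [c ->]; apply/asboolP; exists (fun i => c i * r).
    by rewrite mulr_suml; apply: eq_bigr => i _; rewrite !mulrA.
- move=> /asboolP [c ->]; apply/asboolP.
  exists (fun i => if (i < n)%N then c i else 0).
  rewrite big_ord_recr /= ltnn mulr0 addr0.
  by apply: eq_bigr => i _; rewrite ltn_ord.
- exists N; apply/asboolP; change (a ^+ N * b \in I N).
  rewrite -(stabN N.+1) //; apply/asboolP.
  exists (fun i => if i == N then 1 else 0).
  rewrite big_ord_recr /= eqxx mulr1 big1 ?add0r // => i _.
  by rewrite ltn_eqF ?mulr0.
Qed.

Lemma right_noetherian_right_ore (A : pzRingType) (a b : A) :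
    no_zero_divisors A -> right_noetherian A -> a != 0 -> b != 0 ->
  exists x y, a * x = b * y /\ b * y != 0.
Proof.
move=> domA noethA a0 b0; have [n [c rel]] := monomial_relation a b noethA.
apply: (@common_multiple_of_relation A a b n.+1
          (fun i => if i == n then - 1 else c i)) => //.
  rewrite big_ord_recr /= eqxx mulrN1 rel; apply/eqP; rewrite subr_eq0.
  by apply/eqP/eq_bigr => i _; rewrite ltn_eqF.
exists n => //; rewrite eqxx oppr_eq0.
(* [1 = 0] would force [b = 0]. *)
by apply: contra b0 => /eqP e; rewrite -[b]mulr1 e mulr0.
Qed.

(** Left ideals of [A] are right ideals of the converse ring [A^c], by
    conversion. *)
Lemma left_noetherian_left_ore (A : pzRingType) (a b : A) :
    no_zero_divisors A -> left_noetherian A -> a != 0 -> b != 0 ->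
  exists x y, x * a = y * b /\ y * b != 0.
Proof.
move=> domA noethA.
by apply: (@right_noetherian_right_ore A^c a b) => // x y /domA [] ->; auto.
Qed.

Lemma subring_no_zero_divisors (R : pzRingType) (S : subringClosed R) :
  no_zero_divisors R -> no_zero_divisors (subring_type S).
Proof.
move=> domR x y /(congr1 val); rewrite rmorphM rmorph0 => /domR.
by case=> e; [left | right]; apply: val_inj; rewrite e rmorph0.
Qed.

Lemma F_noetherian_pair (R : pzRingType) (a b : R) :
  F_noetherian R ->
  exists S : subringClosed R, noetherian (subring_type S) /\
    exists a' b' : subring_type S, val a' = a /\ val b' = b.
Proof.
move=> hF; have [S [subS noethS]] := hF [:: a; b].
have aS : a \in S by apply: subS; rewrite !inE eqxx.
have bS : b \in S by apply: subS; rewrite !inE eqxx orbT.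
by exists S; split=> //; exists (Sub a aS), (Sub b bS); rewrite !SubK.
Qed.

Theorem mainTheorem10 (R : nzRingType) (hdom : domain R)
  (hF : F_noetherian R) : left_ore_domain R /\ right_ore_domain R.
Proof.
have val0 (S : subringClosed R) (x : subring_type S) : (val x == 0) = (x == 0).
  by rewrite -(inj_eq val_inj) rmorph0.
split; split=> // a b.
- have [S [[noethS _] [a' [b' [<- <-]]]]] := F_noetherian_pair a b hF.
  have domS := subring_no_zero_divisors (S := S) hdom.
  rewrite !val0 => a0 b0.
  have [x [y [exy y0]]] := left_noetherian_left_ore domS noethS a0 b0.
  exists (val (y * b')); first by rewrite val0.
  by split; [exists (val x); rewrite -exy | exists (val y)]; rewrite rmorphM.
- have [S [[_ noethS] [a' [b' [<- <-]]]]] := F_noetherian_pair a b hF.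
  have domS := subring_no_zero_divisors (S := S) hdom.
  rewrite !val0 => a0 b0.
  have [x [y [exy y0]]] := right_noetherian_right_ore domS noethS a0 b0.
  exists (val (b' * y)); first by rewrite val0.
  by split; [exists (val x); rewrite -exy | exists (val y)]; rewrite rmorphM.
Qed.
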